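(* Let $(H,\cdot,\eta,\Delta,\epsilon,S,\Psi)$ be a braided Hopf algebra. Define the braided adjoint action $\triangleright: H\otimes H\to H$ by $$h\triangleright g=\cdot\circ(\cdot\otimes S)\circ(\mathrm{id}\otimes\Psi)\circ(\Delta\otimes\mathrm{id})(h\otimes g),\qquad h,g\in H .$$ Then this action, together with $\Xi:=\Psi$ as the braiding between the braided Hopf algebra $H$ and the algebra $H$, makes $H$ a left braided $H$-module algebra.
   Context: All tensor products are over the ground field $\mathbb K$. A braided Hopf algebra $(H,\cdot,\eta,\Delta,\epsilon,S,\Psi)$ is a unital associative algebra and a coassociative counital coalgebra $H$ with an invertible linear map (braiding) $\Psi:H\otimes H\to H\otimes H$ satisfying the braid equation $(\Psi\otimes \mathrm{id})(\mathrm{id}\otimes\Psi)(\Psi\otimes \mathrm{id})=(\mathrm{id}\otimes\Psi)(\Psi\otimes \mathrm{id})(\mathrm{id}\otimes\Psi)$, such that all structure maps are compatible with $\Psi$: $\Psi(\cdot\otimes\mathrm{id})=(\mathrm{id}\otimes\cdot)(\Psi\otimes\mathrm{id})(\mathrm{id}\otimes\Psi)$, $\Psi(\mathrm{id}\otimes\cdot)=(\cdot\otimes\mathrm{id})(\mathrm{id}\otimes\Psi)(\Psi\otimes\mathrm{id})$, $\Psi(1\otimes h)=h\otimes 1$, $\Psi(h\otimes 1)=1\otimes h$, $(\mathrm{id}\otimes\Delta)\Psi=(\Psi\otimes\mathrm{id})(\mathrm{id}\otimes\Psi)(\Delta\otimes\mathrm{id})$, $(\Delta\otimes\mathrm{id})\Psi=(\mathrm{id}\otimes\Psi)(\Psi\otimes\mathrm{id})(\mathrm{id}\otimes\Delta)$,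 $(\mathrm{id}\otimes\epsilon)\Psi=\epsilon\otimes\mathrm{id}$, $(\epsilon\otimes\mathrm{id})\Psi=\mathrm{id}\otimes\epsilon$, $\Psi(S\otimes\mathrm{id})=(\mathrm{id}\otimes S)\Psi$, $\Psi(\mathrm{id}\otimes S)=(S\otimes\mathrm{id})\Psi$; and such that $\epsilon$ is a unital algebra homomorphism, $\Delta(1)=1\otimes1$, $\Delta\circ\cdot=(\cdot\otimes\cdot)(\mathrm{id}\otimes\Psi\otimes\mathrm{id})(\Delta\otimes\Delta)$, and $\cdot(S\otimes\mathrm{id})\Delta=\eta\epsilon=\cdot(\mathrm{id}\otimes S)\Delta$. Let $H$ be a braided Hopf algebra with braiding $\Psi$ and $A$ a unital algebra with product $\cdot_A$. $A$ is a left braided $H$-module algebra if there are a linear map $\triangleright:H\otimes A\to A$ (left action) and a braiding (invertible linear map) $\Xi:H\otimes A\to A\otimes H$ such that (1) $\Xi(\cdot_H\otimes\mathrm{id})=(\mathrm{id}\otimes\cdot_H)(\Xi\otimes\mathrm{id})(\mathrm{id}\otimes\Xi)$; (2) $\Xi(\mathrm{id}\otimes\cdot_A)=(\cdot_A\otimes\mathrm{id})(\mathrm{id}\otimes\Xi)(\Xi\otimes\mathrm{id})$; (3) $(\mathrm{id}\otimes\Delta)\Xi=(\Xi\otimes\mathrm{id})(\mathrm{id}\otimes\Xi)(\Delta\otimes\mathrm{id})$; (4) $\triangleright(\mathrm{id}\otimes\cdot_A)=\cdot_A(\triangleright\otimes\triangleright)(\mathrm{id}\otimes\Xi\otimes\mathrm{id})(\Delta\otimes\mathrm{id}\otimes\mathrm{id})$;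 (5) $\triangleright(\cdot_H\otimes\mathrm{id})=\triangleright(\mathrm{id}\otimes\triangleright)$; (6) $\Xi(\mathrm{id}\otimes\triangleright)=(\triangleright\otimes\mathrm{id})(\mathrm{id}\otimes\Xi)(\Psi\otimes\mathrm{id})$ on $H\otimes H\otimes A$; (7) $1\triangleright a=a$ and $h\triangleright1=\epsilon(h)1$ for all $a\in A$, $h\in H$. *)

(* Defs.v *)
From HB Require Import structures.
From mathcomp Require Import all_boot all_algebra generic_quotient ring_quotient.
From mathcomp Require Import boolp.
From mathcomp.multinomials Require Import freeg.

Set Implicit Arguments.
Unset Strict Implicit.
Unset Printing Implicit Defensive.

Import GRing.Theory.

Local Open Scope ring_scope.

(** * Tensor product of two vector spaces *)

(* Constructed as the free vector space on the set V * W modulo the subspace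
   spanned by the bilinearity relators. *)
Section TensorType.
Variables (K : fieldType) (V W : lmodType K).

Inductive bilin_relation : {freeg (V * W) / K} -> Prop :=
| BilinRel0 : bilin_relation 0
| BilinRelL a x y :
    bilin_relation x -> bilin_relation y -> bilin_relation (a *: x + y)
| BilinRelDl v v' w :
    bilin_relation (<< (v + v', w) >> - << (v, w) >> - << (v', w) >>)
| BilinRelDr v w w' :
    bilin_relation (<< (v, w + w') >> - << (v, w) >> - << (v, w') >>)
| BilinRelZl a v w :
    bilin_relation (<< (a *: v, w) >> - a *: << (v, w) >>)
| BilinRelZr a v w :
    bilin_relation (<< (v, a *: w) >> - a *: << (v, w) >>).

Definition bilin_rel : {pred {freeg (V * W) / K}} := [pred x | `[< bilin_relation x >]].

Lemma bilin_relP x : reflect (bilin_relation x) (x \in bilin_rel).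
Proof. exact: asboolP. Qed.

Lemma bilin_rel_zmod_closed : zmod_closed bilin_rel.
Proof.
split; first by apply/bilin_relP; exact: BilinRel0.
move=> x y /bilin_relP rx /bilin_relP ry; apply/bilin_relP.
by rewrite addrC -scaleN1r; exact: BilinRelL.
Qed.

HB.instance Definition _ :=
  GRing.isZmodClosed.Build {freeg (V * W) / K} bilin_rel bilin_rel_zmod_closed.

Lemma bilin_relZ a x : x \in bilin_rel -> a *: x \in bilin_rel.
Proof.
move=> /bilin_relP rx; apply/bilin_relP.
by rewrite -[a *: x]addr0; apply: BilinRelL => //; exact: BilinRel0.
Qed.

Definition tensor_space : Type := {ideal_quot bilin_rel}.

HB.instance Definition _ := GRing.Zmodule.on tensor_space.
HB.instance Definition _ := Quotient.on tensor_space.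

Definition tensor_pi (x : {freeg (V * W) / K}) : tensor_space := \pi_tensor_space%qT x.

Lemma tensor_piK (t : tensor_space) : tensor_pi (repr t) = t.
Proof. exact: reprK. Qed.

Lemma tensor_pi_eq x y : (tensor_pi x = tensor_pi y) <-> (x - y \in bilin_rel).
Proof.
rewrite /tensor_pi; split.
  by move/eqP; rewrite piE.
by move=> h; apply/eqP; rewrite piE.
Qed.

Lemma tensor_piD x y : tensor_pi (x + y) = tensor_pi x + tensor_pi y.
Proof. by rewrite /tensor_pi piE. Qed.

Definition tensor_scale (a : K) (t : tensor_space) : tensor_space := tensor_pi (a *: repr t).

Lemma tensor_scale_pi a x : tensor_scale a (tensor_pi x) = tensor_pi (a *: x).
Proof.
apply/tensor_pi_eq; rewrite -scalerBr; apply: bilin_relZ.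
by apply/tensor_pi_eq; rewrite tensor_piK.
Qed.

Lemma tensor_scaleA a b t :
  tensor_scale a (tensor_scale b t) = tensor_scale (a * b) t.
Proof. by rewrite -[t]tensor_piK !tensor_scale_pi scalerA. Qed.

Lemma tensor_scale1 t : tensor_scale 1 t = t.
Proof. by rewrite -[t]tensor_piK tensor_scale_pi scale1r. Qed.

Lemma tensor_scaleDr a s t :
  tensor_scale a (s + t) = tensor_scale a s + tensor_scale a t.
Proof.
rewrite -[s]tensor_piK -[t]tensor_piK -tensor_piD !tensor_scale_pi.
by rewrite scalerDr tensor_piD.
Qed.

Lemma tensor_scaleDl t a b :
  tensor_scale (a + b) t = tensor_scale a t + tensor_scale b t.
Proof. by rewrite -[t]tensor_piK !tensor_scale_pi scalerDl tensor_piD. Qed.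

HB.instance Definition _ := GRing.Zmodule_isLmodule.Build K tensor_space
  tensor_scaleA tensor_scale1 tensor_scaleDr tensor_scaleDl.

Definition tensor : lmodType K := tensor_space.

Lemma tensor_piZ a x : tensor_pi (a *: x) = a *: (tensor_pi x : tensor).
Proof. exact/esym/tensor_scale_pi. Qed.

Lemma tensor_pi_is_linear : linear (tensor_pi : _ -> tensor).
Proof. by move=> a x y; rewrite tensor_piD tensor_piZ. Qed.

HB.instance Definition _ :=
  GRing.isLinear.Build K {freeg (V * W) / K} tensor_space *:%R tensor_pi
    tensor_pi_is_linear.

Definition tens (v : V) (w : W) : tensor := tensor_pi << (v, w) >>.

Lemma tensDl v v' w : tens (v + v') w = tens v w + tens v' w.
Proof.
apply/eqP; rewrite -tensor_piD; apply/eqP/tensor_pi_eq/bilin_relP.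
by rewrite opprD addrA; exact: BilinRelDl.
Qed.

Lemma tensDr v w w' : tens v (w + w') = tens v w + tens v w'.
Proof.
apply/eqP; rewrite -tensor_piD; apply/eqP/tensor_pi_eq/bilin_relP.
by rewrite opprD addrA; exact: BilinRelDr.
Qed.

Lemma tensZl a v w : tens (a *: v) w = a *: tens v w.
Proof. by rewrite -tensor_piZ; apply/tensor_pi_eq/bilin_relP/BilinRelZl. Qed.

Lemma tensZr a v w : tens v (a *: w) = a *: tens v w.
Proof. by rewrite -tensor_piZ; apply/tensor_pi_eq/bilin_relP/BilinRelZr. Qed.

Lemma tens_is_bilinear : bilinear_for *:%R *:%R tens.
Proof.
by split=> [w a v v'|v a w w']; rewrite ?tensDl ?tensZl ?tensDr ?tensZr.
Qed.

HB.instance Definition _ :=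
  bilinear_isBilinear.Build K V W tensor *:%R *:%R tens tens_is_bilinear.

Lemma tensor_ind (P : tensor -> Prop) :
    (forall v w, P (tens v w)) -> P 0 -> (forall s t, P s -> P t -> P (s + t)) ->
  forall t, P t.
Proof.
move=> Ptens P0 PD t; rewrite -[t]tensor_piK -[repr t]freeg_sumE.
rewrite linear_sum; elim/big_ind: _ => // -[v w] _.
set c := coeff _ _; suff -> : << c *g (v, w) >> = c *: << (v, w) >> :> {freeg (V * W) / K}.
  by rewrite linearZ /= -[tensor_pi _]/(tens v w) -tensZl.
by apply/eqP/freeg_eqP=> x; rewrite coeffZ !coeffU mul1r.
Qed.

Lemma tensor_linear_ext (U : lmodType K) (f g : {linear tensor -> U}) :
  (forall v w, f (tens v w) = g (tens v w)) -> f =1 g.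
Proof.
move=> fg; elim/tensor_ind => [//||s t es et]; first by rewrite !linear0.
by rewrite !linearD /= es et.
Qed.

Section Lift.
Variables (U : lmodType K) (f : {bilinear V -> W -> U}).

Definition freeg_lift (x : {freeg (V * W) / K}) : U :=
  fglift (fun p : V * W => f p.1 p.2) x.

Lemma freeg_liftU a p : freeg_lift << a *g p >> = a *: f p.1 p.2.
Proof. exact: liftU. Qed.

Lemma freeg_liftD x y : freeg_lift (x + y) = freeg_lift x + freeg_lift y.
Proof.
have fB s t : freeg_lift (s - t) = freeg_lift s - freeg_lift t.
  exact: (@lift_is_additive K (V * W)%type U (fun p => f p.1 p.2)).
rewrite -[y in LHS]opprK (fB x (- y)); congr (_ + _).
by rewrite -(sub0r y) (fB 0 y) -(subrr 0) (fB 0 0) !subrr sub0r opprK.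
Qed.

Lemma freeg_lift0 : freeg_lift 0 = 0.
Proof. by apply: (addrI (freeg_lift 0)); rewrite -freeg_liftD !addr0. Qed.

Lemma freeg_lift_sum I (r : seq I) (F : I -> {freeg (V * W) / K}) :
  freeg_lift (\sum_(i <- r) F i) = \sum_(i <- r) freeg_lift (F i).
Proof. exact: (big_morph _ freeg_liftD freeg_lift0). Qed.

Lemma freeg_liftZ a x : freeg_lift (a *: x) = a *: freeg_lift x.
Proof.
rewrite -[x]freeg_sumE scaler_sumr !freeg_lift_sum scaler_sumr.
apply: eq_bigr => p _; set c := coeff _ _.
suff -> : a *: << c *g p >> = << (a * c) *g p >> :> {freeg (V * W) / K}.
  by rewrite !freeg_liftU scalerA.
by apply/eqP/freeg_eqP=> y; rewrite coeffZ !coeffU mulrA.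
Qed.

Lemma freeg_lift_rel x : x \in bilin_rel -> freeg_lift x = 0.
Proof.
have fN y : freeg_lift (- y) = - freeg_lift y.
  by rewrite -[in LHS]scaleN1r freeg_liftZ scaleN1r.
move=> /bilin_relP; elim=> {x}.
- exact: freeg_lift0.
- by move=> a x y _ ex _ ey; rewrite freeg_liftD freeg_liftZ ex ey scaler0 addr0.
- move=> v v' w; rewrite !freeg_liftD !fN !freeg_liftU !scale1r /= linearDl.
  by rewrite -addrA -opprD subrr.
- move=> v w w'; rewrite !freeg_liftD !fN !freeg_liftU !scale1r /= linearDr.
  by rewrite -addrA -opprD subrr.
- move=> a v w; rewrite freeg_liftD fN freeg_liftZ !freeg_liftU !scale1r /=.
  by rewrite linearZl_LR subrr.
- move=> a v w; rewrite freeg_liftD fN freeg_liftZ !freeg_liftU !scale1r /=.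
  by rewrite linearZr_LR subrr.
Qed.

Definition tensor_lift (t : tensor) : U := freeg_lift (repr t).

Lemma tensor_lift_pi x : tensor_lift (tensor_pi x) = freeg_lift x.
Proof.
apply/eqP; rewrite -subr_eq0 -scaleN1r -freeg_liftZ scaleN1r -freeg_liftD.
apply/eqP; apply: freeg_lift_rel; apply/tensor_pi_eq; exact: tensor_piK.
Qed.

Lemma tensor_lift_is_linear : linear tensor_lift.
Proof.
move=> a s t; rewrite -[s]tensor_piK -[t]tensor_piK -linearP !tensor_lift_pi.
by rewrite freeg_liftD freeg_liftZ.
Qed.

HB.instance Definition _ :=
  GRing.isLinear.Build K tensor U *:%R tensor_lift tensor_lift_is_linear.

Lemma tensor_liftE v w : tensor_lift (tens v w) = f v w.
Proof. by rewrite tensor_lift_pi freeg_liftU scale1r. Qed.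
End Lift.

End TensorType.

Notation "V ⊗ W" := (tensor V W) (at level 40, left associativity).
Notation "v ⊗ₜ w" := (tens v w) (at level 40, left associativity) : ring_scope.

(** * Tensor products of linear maps, associator and unitors *)

Section TensorMap.
Variables (K : fieldType) (V V' W W' : lmodType K).
Variables (f : {linear V -> V'}) (g : {linear W -> W'}).

Definition tmap_fun (v : V) (w : W) : V' ⊗ W' := f v ⊗ₜ g w.

Lemma tmap_fun_is_bilinear : bilinear_for *:%R *:%R tmap_fun.
Proof.
by split=> [w a v v'|v a w w'];
   rewrite /tmap_fun linearP ?tensDl ?tensZl ?tensDr ?tensZr.
Qed.

HB.instance Definition _ :=
  bilinear_isBilinear.Build K V W (V' ⊗ W') *:%R *:%R
    tmap_fun tmap_fun_is_bilinear.

Definition tmap : {linear V ⊗ W -> V' ⊗ W'} := tensor_lift tmap_fun.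

Lemma tmapE v w : tmap (v ⊗ₜ w) = f v ⊗ₜ g w.
Proof. exact: tensor_liftE. Qed.
End TensorMap.

Notation "f ⊠ g" := (tmap f g) (at level 40, left associativity) : ring_scope.

Section Associator.
Variables (K : fieldType) (U V W : lmodType K).

Definition assocl_fun1 (w : W) (u : U) (v : V) : U ⊗ (V ⊗ W) := u ⊗ₜ (v ⊗ₜ w).

Lemma assocl_fun1_is_bilinear w : bilinear_for *:%R *:%R (assocl_fun1 w).
Proof.
by split=> [v a u u'|u a v v']; rewrite /assocl_fun1;
   rewrite ?tensDl ?tensZl ?tensDr ?tensZr.
Qed.

HB.instance Definition _ w :=
  bilinear_isBilinear.Build K U V (U ⊗ (V ⊗ W)) *:%R *:%R
    (assocl_fun1 w) (assocl_fun1_is_bilinear w).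

Definition assocl_fun (t : U ⊗ V) (w : W) : U ⊗ (V ⊗ W) :=
  tensor_lift (assocl_fun1 w) t.

Lemma assocl_fun_is_bilinear : bilinear_for *:%R *:%R assocl_fun.
Proof.
split=> [w a s t|t a w w']; rewrite /assocl_fun ?linearP //.
elim/tensor_ind: t => [u v||s t es et]; last 1 first.
- by rewrite !linearD /= es et scalerDr !addrA; congr (_ + _); rewrite addrAC.
- by rewrite !tensor_liftE /= /assocl_fun1 !(tensDr, tensZr).
by rewrite !linear0 /= scaler0 addr0.
Qed.

HB.instance Definition _ :=
  bilinear_isBilinear.Build K (U ⊗ V) W (U ⊗ (V ⊗ W)) *:%R *:%R
    assocl_fun assocl_fun_is_bilinear.

Definition assocl : {linear U ⊗ V ⊗ W -> U ⊗ (V ⊗ W)} := tensor_lift assocl_fun.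

Lemma assoclE u v w : assocl (u ⊗ₜ v ⊗ₜ w) = u ⊗ₜ (v ⊗ₜ w).
Proof. by rewrite /assocl /= tensor_liftE /= /assocl_fun tensor_liftE. Qed.

Definition assocr_fun1 (u : U) (v : V) (w : W) : U ⊗ V ⊗ W := u ⊗ₜ v ⊗ₜ w.

Lemma assocr_fun1_is_bilinear u : bilinear_for *:%R *:%R (assocr_fun1 u).
Proof.
by split=> [w a v v'|v a w w']; rewrite /assocr_fun1;
   rewrite ?(tensDl, tensZl, tensDr, tensZr).
Qed.

HB.instance Definition _ u :=
  bilinear_isBilinear.Build K V W (U ⊗ V ⊗ W) *:%R *:%R
    (assocr_fun1 u) (assocr_fun1_is_bilinear u).

Definition assocr_fun (u : U) (t : V ⊗ W) : U ⊗ V ⊗ W :=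
  tensor_lift (assocr_fun1 u) t.

Lemma assocr_fun_is_bilinear : bilinear_for *:%R *:%R assocr_fun.
Proof.
split=> [t a u u'|u a s t]; rewrite /assocr_fun ?linearP //.
elim/tensor_ind: t => [v w||s t es et]; last 1 first.
- by rewrite !linearD /= es et scalerDr !addrA; congr (_ + _); rewrite addrAC.
- by rewrite !tensor_liftE /= /assocr_fun1 !(tensDl, tensZl).
by rewrite !linear0 /= scaler0 addr0.
Qed.

HB.instance Definition _ :=
  bilinear_isBilinear.Build K U (V ⊗ W) (U ⊗ V ⊗ W) *:%R *:%R
    assocr_fun assocr_fun_is_bilinear.

Definition assocr : {linear U ⊗ (V ⊗ W) -> U ⊗ V ⊗ W} := tensor_lift assocr_fun.

Lemma assocrE u v w : assocr (u ⊗ₜ (v ⊗ₜ w)) = u ⊗ₜ v ⊗ₜ w.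
Proof. by rewrite /assocr /= tensor_liftE /= /assocr_fun tensor_liftE. Qed.

Lemma assoclK : cancel assocl assocr.
Proof.
elim/tensor_ind=> [t w||s t es et]; rewrite ?linear0 ?linearD /= ?es ?et //.
elim/tensor_ind: t => [u v||s t es et]; first by rewrite assoclE assocrE.
  by rewrite linear0l !linear0.
by rewrite linearDl !linearD /= es et.
Qed.

Lemma assocrK : cancel assocr assocl.
Proof.
elim/tensor_ind=> [u t||s t es et]; rewrite ?linear0 ?linearD /= ?es ?et //.
elim/tensor_ind: t => [v w||s t es et]; first by rewrite assocrE assoclE.
  by rewrite linear0r !linear0.
by rewrite linearDr !linearD /= es et.
Qed.
End Associator.

Section Unitors.
Variables (K : fieldType) (V : lmodType K).

Definition lunit_fun (a : K^o) (v : V) : V := (a : K) *: v.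

Lemma lunit_fun_is_bilinear : bilinear_for *:%R *:%R lunit_fun.
Proof.
split=> [v a b c|b a v w]; rewrite /lunit_fun; first by rewrite scalerDl -scalerA.
by rewrite scalerDr scalerA mulrC -scalerA.
Qed.

HB.instance Definition _ :=
  bilinear_isBilinear.Build K K^o V V *:%R *:%R lunit_fun lunit_fun_is_bilinear.

Definition lunit : {linear K^o ⊗ V -> V} := tensor_lift lunit_fun.

Lemma lunitE (a : K^o) v : lunit (a ⊗ₜ v) = (a : K) *: v.
Proof. exact: tensor_liftE. Qed.

Definition runit_fun (v : V) (a : K^o) : V := (a : K) *: v.

Lemma runit_fun_is_bilinear : bilinear_for *:%R *:%R runit_fun.
Proof. by split=> [a|v]; [exact: lunit_fun_is_bilinear.2 | exact: lunit_fun_is_bilinear.1]. Qed.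

HB.instance Definition _ :=
  bilinear_isBilinear.Build K V K^o V *:%R *:%R runit_fun runit_fun_is_bilinear.

Definition runit : {linear V ⊗ K^o -> V} := tensor_lift runit_fun.

Lemma runitE v (a : K^o) : runit (v ⊗ₜ a) = (a : K) *: v.
Proof. exact: tensor_liftE. Qed.
End Unitors.

Section AlgebraMap.
Variables (K : fieldType) (A : algType K).

Definition amul (x y : A) : A := x * y.

Lemma amul_is_bilinear : bilinear_for *:%R *:%R amul.
Proof.
split=> [y a x x'|x a y y']; rewrite /amul; first by rewrite mulrDl -scalerAl.
by rewrite mulrDr -scalerAr.
Qed.

HB.instance Definition _ :=
  bilinear_isBilinear.Build K A A A *:%R *:%R amul amul_is_bilinear.

Definition tmul : {linear A ⊗ A -> A} := tensor_lift amul.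

Lemma tmulE x y : tmul (x ⊗ₜ y) = x * y.
Proof. exact: tensor_liftE. Qed.
End AlgebraMap.

Arguments assocl {K U V W}.
Arguments assocr {K U V W}.
Arguments lunit {K V}.
Arguments runit {K V}.
Arguments tmul {K A}.

(** * Braided Hopf algebras and braided module algebras *)

(* Triple tensor products are nested to the left: the map id ⊗ f on U ⊗ V ⊗ W is
   [idr f].  Four-fold ones are nested in pairs, (U ⊗ V) ⊗ (W ⊗ X), and the map
   id ⊗ f ⊗ id is [idmid f]. *)
Section Legs.
Variable K : fieldType.

Definition idr (U V W V' W' : lmodType K) (f : {linear V ⊗ W -> V' ⊗ W'}) :
    {linear U ⊗ V ⊗ W -> U ⊗ V' ⊗ W'} :=
  assocr \o (idfun ⊠ f) \o assocl.

Definition idmid (U V W X V' W' : lmodType K)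
    (f : {linear V ⊗ W -> V' ⊗ W'}) :
    {linear (U ⊗ V) ⊗ (W ⊗ X) -> (U ⊗ V') ⊗ (W' ⊗ X)} :=
  assocr \o (idfun ⊠ (assocl \o (f ⊠ idfun) \o assocr)) \o assocl.
End Legs.

Arguments idr {K U V W V' W'} f.
Arguments idmid {K U V W X V' W'} f.

(* The unital associative algebra structure of H is its [algType] structure. *)
Record braided_Hopf_algebra (K : fieldType) (H : algType K)
    (Delta : {linear H -> H ⊗ H}) (eps : {linear H -> K^o})
    (S : {linear H -> H}) (Psi : {linear H ⊗ H -> H ⊗ H}) : Prop := {
  coassociative : assocl \o (Delta ⊠ idfun) \o Delta =1 (idfun ⊠ Delta) \o Delta;
  counitl : lunit \o (eps ⊠ idfun) \o Delta =1 idfun;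
  counitr : runit \o (idfun ⊠ eps) \o Delta =1 idfun;

  braiding_bij : bijective Psi;
  braid_eq : (Psi ⊠ idfun) \o idr Psi \o (Psi ⊠ idfun)
             =1 idr Psi \o (Psi ⊠ idfun) \o idr Psi;

  braiding_mull : Psi \o (tmul ⊠ idfun)
                  =1 (idfun ⊠ tmul) \o assocl \o (Psi ⊠ idfun) \o idr Psi;
  braiding_mulr : Psi \o (idfun ⊠ tmul) \o assocl
                  =1 (tmul ⊠ idfun) \o idr Psi \o (Psi ⊠ idfun);
  braiding_1l : forall h, Psi (1 ⊗ₜ h) = h ⊗ₜ 1;
  braiding_1r : forall h, Psi (h ⊗ₜ 1) = 1 ⊗ₜ h;
  braiding_Deltar : assocr \o (idfun ⊠ Delta) \o Psi
                    =1 (Psi ⊠ idfun) \o idr Psi \o (Delta ⊠ idfun);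
  braiding_Deltal : (Delta ⊠ idfun) \o Psi
                    =1 idr Psi \o (Psi ⊠ idfun) \o assocr \o (idfun ⊠ Delta);
  braiding_epsr : runit \o (idfun ⊠ eps) \o Psi =1 lunit \o (eps ⊠ idfun);
  braiding_epsl : lunit \o (eps ⊠ idfun) \o Psi =1 runit \o (idfun ⊠ eps);
  braiding_Sl : Psi \o (S ⊠ idfun) =1 (idfun ⊠ S) \o Psi;
  braiding_Sr : Psi \o (idfun ⊠ S) =1 (S ⊠ idfun) \o Psi;

  counit1 : eps 1 = 1;
  counitM : forall g h, eps (g * h) = eps g * eps h;
  comul1 : Delta 1 = 1 ⊗ₜ 1;
  comulM : Delta \o tmul =1 (tmul ⊠ tmul) \o idmid Psi \o (Delta ⊠ Delta);
  antipodel : forall h, tmul ((S ⊠ idfun) (Delta h)) = eps h *: 1;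
  antipoder : forall h, tmul ((idfun ⊠ S) (Delta h)) = eps h *: 1
}.

(* The axioms on the data (act, Xi) that make A a left braided module algebra
   over the braided Hopf algebra H; only the structure maps Delta, eps and Psi
   of H occur in them. *)
Record left_braided_module_algebra (K : fieldType) (H A : algType K)
    (Delta : {linear H -> H ⊗ H}) (eps : {linear H -> K^o})
    (Psi : {linear H ⊗ H -> H ⊗ H})
    (act : {linear H ⊗ A -> A}) (Xi : {linear H ⊗ A -> A ⊗ H}) : Prop := {
  module_braiding_bij : bijective Xi;
  module_braiding_mulH : Xi \o (tmul ⊠ idfun)
                         =1 (idfun ⊠ tmul) \o assocl \o (Xi ⊠ idfun) \o idr Xi;
  module_braiding_mulA : Xi \o (idfun ⊠ tmul) \o assocl
                         =1 (tmul ⊠ idfun) \o idr Xi \o (Xi ⊠ idfun);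
  module_braiding_Delta : assocr \o (idfun ⊠ Delta) \o Xi
                          =1 (Xi ⊠ idfun) \o idr Xi \o (Delta ⊠ idfun);
  act_mulA : act \o (idfun ⊠ tmul)
             =1 tmul \o (act ⊠ act) \o idmid Xi \o (Delta ⊠ idfun);
  act_mulH : act \o (tmul ⊠ idfun) =1 act \o (idfun ⊠ act) \o assocl;
  module_braiding_act : Xi \o (idfun ⊠ act) \o assocl
                        =1 (act ⊠ idfun) \o idr Xi \o (Psi ⊠ idfun);
  act1l : forall a : A, act (1 ⊗ₜ a) = a;
  act1r : forall h : H, act (h ⊗ₜ 1) = eps h *: 1
}.

Definition braided_adjoint (K : fieldType) (H : algType K)
    (Delta : {linear H -> H ⊗ H}) (S : {linear H -> H})
    (Psi : {linear H ⊗ H -> H ⊗ H}) : {linear H ⊗ H -> H} :=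
  tmul \o (tmul ⊠ S) \o idr Psi \o (Delta ⊠ idfun).

(* Main.v *)
From HB Require Import structures.
Require Import Defs.
From mathcomp Require Import all_boot all_algebra.

Set Implicit Arguments.
Unset Strict Implicit.
Unset Printing Implicit Defensive.

Import GRing.Theory.

Local Open Scope ring_scope.

(* Convolution on maps [H ⊗ H -> H], with the braided coproduct of [H ⊗ H],
   shows that the antipode is antimultiplicative up to [Psi]: both [S ∘ μ] and
   [μ ∘ Psi ∘ (S ⊗ S)] are inverse to [μ].  Compatibility with the product of
   [H] follows from this; compatibility with the product of the algebra follows
   from the identity [h a = (h_(1) ▷ a) h_(2)] (up to braiding), applied to the
   left factor [h_(1) a] of [h_(1) a b S(h_(2))]; compatibility with the
   braiding is the naturality of [Psi] for each structure map, together with the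
   braid equation. *)

(** * Bundled linear maps and their elementary constructions *)

Section LinearMaps.
Variable K : fieldType.

Record lin (X Y : lmodType K) := Lin { fn :> X -> Y; fn_linear : linear fn }.

HB.instance Definition _ (X Y : lmodType K) (f : lin X Y) :=
  GRing.isLinear.Build K X Y *:%R (fn f) (@fn_linear X Y f).

(* The operators are built through opaque existence proofs, so that unification
   never unfolds them into tensor products of maps. *)
Section Build.
Variables X Y Z V W : lmodType K.

Fact to_lin_spec (f : {linear X -> Y}) : {g : lin X Y | forall x, g x = f x}.
Proof. by exists (Lin (linearP f)). Qed.
Definition to_lin f := sval (to_lin_spec f).
Lemma to_linE f x : to_lin f x = f x.
Proof. exact: svalP (to_lin_spec f) x. Qed.

Fact lcomp_spec (f : lin Y Z) (g : lin X Y) :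
  {h : lin X Z | forall x, h x = f (g x)}.
Proof. by exists (Lin (linearP (fn f \o fn g))). Qed.
Definition lcomp f g := sval (lcomp_spec f g).
Lemma lcompE f g x : lcomp f g x = f (g x).
Proof. exact: svalP (lcomp_spec f g) x. Qed.

Fact tensr_spec (w : W) : {f : lin V (V ⊗ W) | forall v, f v = v ⊗ₜ w}.
Proof.
have lin_w : linear (fun v : V => v ⊗ₜ w) by move=> a u v; rewrite tensDl tensZl.
by exists (Lin lin_w).
Qed.
Definition tensr w := sval (tensr_spec w).
Lemma tensrE w v : tensr w v = v ⊗ₜ w.
Proof. exact: svalP (tensr_spec w) v. Qed.

Fact tensl_spec (v : V) : {f : lin W (V ⊗ W) | forall w, f w = v ⊗ₜ w}.
Proof.
have lin_v : linear (fun w : W => v ⊗ₜ w) by move=> a u w; rewrite tensDr tensZr.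
by exists (Lin lin_v).
Qed.
Definition tensl v := sval (tensl_spec v).
Lemma tenslE v w : tensl v w = v ⊗ₜ w.
Proof. exact: svalP (tensl_spec v) w. Qed.
End Build.

End LinearMaps.

Arguments tensr {K} V {W} w.
Arguments tensl {K V W} v.

(* Maps between tensor powers are computed inside the endofunctor [X ↦ H ⊗ X]:
   tensors are nested to the right with an arbitrary last factor [X], the
   structure maps act on the leftmost factors, and [L f] is [id ⊗ f].  So no
   associator occurs, and operators on disjoint factors commute by naturality
   in [X].  [M], [U], [P], [D], [A], [E] stand for the product, unit, braiding,
   coproduct, antipode and counit, and [B] for the adjoint action; [J2 x] and
   [J3 x] append the last factor [x] to a left-nested tensor. *)
Section LeftTensor.
Variables (K : fieldType) (H : algType K).
Local Notation F X := (H ⊗ X).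

Lemma lin_ext (V W Y : lmodType K) (f g : lin (V ⊗ W) Y) :
  (forall v w, f (v ⊗ₜ w) = g (v ⊗ₜ w)) -> f =1 g.
Proof. exact: tensor_linear_ext. Qed.

Lemma tens_congl (V W : lmodType K) (v v' : V) (w : W) :
  v = v' -> v ⊗ₜ w = v' ⊗ₜ w.
Proof. by move=> ->. Qed.

(** Operator identities hold for every last factor; taking [1 : K^o] there and applying the right
    unitor recovers identities in the original spaces. *)
Lemma tens1_inj (V : lmodType K) (v w : V) :
  v ⊗ₜ (1 : K^o) = w ⊗ₜ (1 : K^o) -> v = w.
Proof. by move=> /(congr1 runit); rewrite !runitE !scale1r. Qed.

Fact L_spec (X Y : lmodType K) (f : lin X Y) :
  {Lf : lin (F X) (F Y) | forall h x, Lf (h ⊗ₜ x) = h ⊗ₜ f x}.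
Proof. by exists (Lin (linearP (idfun ⊠ fn f))) => h x; rewrite /= tmapE. Qed.
Definition L (X Y : lmodType K) (f : lin X Y) := sval (L_spec f).
Lemma LE (X Y : lmodType K) (f : lin X Y) h x : L f (h ⊗ₜ x) = h ⊗ₜ f x.
Proof. exact: svalP (L_spec f) h x. Qed.

(** * Functoriality of [H ⊗ -] *)

Section Functor.
Variables X Y Z : lmodType K.

Lemma Lcomp (f : lin Y Z) (g : lin X Y) t : L (lcomp f g) t = L f (L g t).
Proof.
rewrite -lcompE; move: t; apply: lin_ext => h x.
by rewrite lcompE !LE lcompE.
Qed.

Lemma L_ext (f g : lin X Y) : f =1 g -> L f =1 L g.
Proof. by move=> fg; apply: lin_ext => h x; rewrite !LE fg. Qed.

Lemma L_id (f : lin X X) : f =1 id -> L f =1 id.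
Proof.
move=> f1 t; rewrite -[RHS](to_linE idfun); move: t; apply: lin_ext => h x.
by rewrite LE f1 to_linE.
Qed.
End Functor.

(* [Lmn] applies [L] to an identity between composites of [m] and [n] maps. *)
Section Lift.
Variables X0 X1 X2 X3 X4 Y1 Y2 Y3 : lmodType K.

Lemma L20 (f : lin X1 X0) (g : lin X0 X1) :
  (forall t, f (g t) = t) -> forall t, L f (L g t) = t.
Proof. by move=> e t; rewrite -Lcomp; apply: L_id => x; rewrite lcompE. Qed.

Lemma L21 (f : lin X1 X2) (g : lin X0 X1) (f' : lin X0 X2) :
  (forall t, f (g t) = f' t) -> forall t, L f (L g t) = L f' t.
Proof. by move=> e t; rewrite -Lcomp; apply: L_ext => x; rewrite lcompE. Qed.

Lemma L22 (f : lin X1 X2) (g : lin X0 X1) (f' : lin Y1 X2) (g' : lin X0 Y1) :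
  (forall t, f (g t) = f' (g' t)) -> forall t, L f (L g t) = L f' (L g' t).
Proof.
by move=> e t; rewrite -!Lcomp; apply: L_ext => x; rewrite !lcompE.
Qed.

Lemma L23 (f : lin X1 X2) (g : lin X0 X1)
    (f' : lin Y2 X2) (g' : lin Y1 Y2) (h' : lin X0 Y1) :
  (forall t, f (g t) = f' (g' (h' t))) ->
  forall t, L f (L g t) = L f' (L g' (L h' t)).
Proof.
by move=> e t; rewrite -!Lcomp; apply: L_ext => x; rewrite !lcompE.
Qed.

Lemma L32 (f : lin X2 X3) (g : lin X1 X2) (h : lin X0 X1)
    (f' : lin Y1 X3) (g' : lin X0 Y1) :
  (forall t, f (g (h t)) = f' (g' t)) ->
  forall t, L f (L g (L h t)) = L f' (L g' t).
Proof.
by move=> e t; rewrite -!Lcomp; apply: L_ext => x; rewrite !lcompE.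
Qed.

Lemma L33 (f : lin X2 X3) (g : lin X1 X2) (h : lin X0 X1)
    (f' : lin Y2 X3) (g' : lin Y1 Y2) (h' : lin X0 Y1) :
  (forall t, f (g (h t)) = f' (g' (h' t))) ->
  forall t, L f (L g (L h t)) = L f' (L g' (L h' t)).
Proof.
by move=> e t; rewrite -!Lcomp; apply: L_ext => x; rewrite !lcompE.
Qed.

Lemma L24 (f : lin X1 X2) (g : lin X0 X1)
    (f' : lin Y3 X2) (g' : lin Y2 Y3) (h' : lin Y1 Y2) (k' : lin X0 Y1) :
  (forall t, f (g t) = f' (g' (h' (k' t)))) ->
  forall t, L f (L g t) = L f' (L g' (L h' (L k' t))).
Proof.
by move=> e t; rewrite -!Lcomp; apply: L_ext => x; rewrite !lcompE.
Qed.

Lemma L43 (f : lin X3 X4) (g : lin X2 X3) (h : lin X1 X2) (k : lin X0 X1)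
    (f' : lin Y2 X4) (g' : lin Y1 Y2) (h' : lin X0 Y1) :
  (forall t, f (g (h (k t))) = f' (g' (h' t))) ->
  forall t, L f (L g (L h (L k t))) = L f' (L g' (L h' t)).
Proof.
by move=> e t; rewrite -!Lcomp; apply: L_ext => x; rewrite !lcompE.
Qed.
End Lift.

(** * Passage from left-nested to right-nested tensors *)

Section Legs.
Variable X : lmodType K.

Fact J2_spec (x : X) :
  {f : lin (H ⊗ H) (F (F X)) | forall h g, f (h ⊗ₜ g) = h ⊗ₜ (g ⊗ₜ x)}.
Proof.
exists (lcomp (to_lin assocl) (tensr (H ⊗ H) x)) => h g.
by rewrite lcompE tensrE to_linE assoclE.
Qed.
Definition J2 x := sval (J2_spec x).
Lemma J2E x h g : J2 x (h ⊗ₜ g) = h ⊗ₜ (g ⊗ₜ x).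
Proof. exact: svalP (J2_spec x) h g. Qed.

Lemma J2_assocl x y : assocl (y ⊗ₜ x) = J2 x y.
Proof.
rewrite -(to_linE assocl) -(tensrE x) -lcompE.
by move: y; apply: lin_ext => h g; rewrite lcompE tensrE to_linE assoclE J2E.
Qed.

Lemma assocr_J2 x y : to_lin assocr (J2 x y) = y ⊗ₜ x.
Proof.
rewrite -(tensrE x) -lcompE.
by move: y; apply: lin_ext => h g; rewrite lcompE tensrE to_linE J2E assocrE.
Qed.
End Legs.

Lemma J2_inj : injective (J2 (1 : K^o)).
Proof.
move=> y z /(congr1 (to_lin assocr)).
by rewrite !assocr_J2; exact: tens1_inj.
Qed.

Section Legs3.
Variable X : lmodType K.

Fact J3_spec (x : X) :
  {f : lin (H ⊗ H ⊗ H) (F (F (F X))) | forall y k, f (y ⊗ₜ k) = J2 (k ⊗ₜ x) y}.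
Proof.
exists (lcomp (to_lin assocl) (lcomp (to_lin assocl) (tensr (H ⊗ H ⊗ H) x))).
by move=> y k; rewrite !lcompE tensrE !to_linE assoclE J2_assocl.
Qed.
Definition J3 x := sval (J3_spec x).
Lemma J3E x y k : J3 x (y ⊗ₜ k) = J2 (k ⊗ₜ x) y.
Proof. exact: svalP (J3_spec x) y k. Qed.

Lemma J3_assocr x h z : J3 x (assocr (h ⊗ₜ z)) = h ⊗ₜ J2 x z.
Proof.
rewrite -(to_linE assocr) -(tenslE h z) -(tenslE h (J2 x z)) -!lcompE.
move: z; apply: lin_ext => k l; rewrite !lcompE !tenslE to_linE J2E.
by rewrite assocrE J3E J2E.
Qed.
End Legs3.

(** Generators are kept in the form [J2 x y] because the rules for operators are stated with [y]
    arbitrary: a value such as [Psi y] need not be a pure tensor. *)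
Lemma lin_ext2 (X Y : lmodType K) (f g : lin (F (F X)) Y) :
  (forall x h k, f (J2 x (h ⊗ₜ k)) = g (J2 x (h ⊗ₜ k))) -> f =1 g.
Proof.
move=> fg; apply: lin_ext => h t; rewrite -(tenslE h) -!lcompE.
by move: t; apply: lin_ext => k x; rewrite !lcompE !tenslE -J2E fg.
Qed.

Lemma lin_ext3 (X Y : lmodType K) (f g : lin (F (F (F X))) Y) :
  (forall x h k l, f (J3 x (h ⊗ₜ k ⊗ₜ l)) = g (J3 x (h ⊗ₜ k ⊗ₜ l))) -> f =1 g.
Proof.
move=> fg; apply: lin_ext => h t; rewrite -(tenslE h) -!lcompE.
move: t; apply: lin_ext2 => x k l; rewrite !lcompE !tenslE.
by rewrite J2E -J2E -J3E fg.
Qed.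

Fact M_spec (X : lmodType K) :
  {m : lin (F (F X)) (F X) | forall x y, m (J2 x y) = tmul y ⊗ₜ x}.
Proof.
exists (lcomp (to_lin (tmul ⊠ idfun)) (to_lin assocr)) => x y.
by rewrite lcompE assocr_J2 to_linE tmapE.
Qed.
Definition M X := sval (M_spec X).
Lemma M_J2 (X : lmodType K) (x : X) y : M X (J2 x y) = tmul y ⊗ₜ x.
Proof. exact: svalP (M_spec X) x y. Qed.

Fact U_spec (X : lmodType K) : {u : lin X (F X) | forall x, u x = 1 ⊗ₜ x}.
Proof. by exists (tensl 1) => x; rewrite tenslE. Qed.
Definition U X := sval (U_spec X).
Lemma UE (X : lmodType K) (x : X) : U X x = 1 ⊗ₜ x.
Proof. exact: svalP (U_spec X) x. Qed.

Lemma L2_J2 (X Y : lmodType K) (f : lin X Y) x y : L (L f) (J2 x y) = J2 (f x) y.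
Proof.
elim/tensor_ind: y => [h g||s t es et]; last by rewrite !linearD /= es et.
  by rewrite !J2E !LE.
by rewrite !linear0.
Qed.

(** * Binary operations on the two leftmost factors, for the product and the adjoint action alike *)

Section BinaryOperator.
Variables (f : {linear H ⊗ H -> H}).
Variable g : forall X : lmodType K, lin (F (F X)) (F X).
Hypothesis gE : forall (X : lmodType K) (x : X) y, g X (J2 x y) = f y ⊗ₜ x.

Lemma binop_J3 (X : lmodType K) (x : X) z :
  g _ (J3 x z) = J2 x ((f ⊠ idfun) z).
Proof.
elim/tensor_ind: z => [y k||s t es et]; last by rewrite !linearD /= es et.
  by rewrite J3E gE tmapE J2E.
by rewrite !linear0.
Qed.

Lemma L_binop_J3 (X : lmodType K) (x : X) z :
  L (g X) (J3 x z) = J2 x ((idfun ⊠ f) (assocl z)).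
Proof.
elim/tensor_ind: z => [y k||s t es et]; last by rewrite !linearD /= es et.
  elim/tensor_ind: y => [h l||s t es et]; last first.
  - by rewrite !linearDl !linearD /= es et.
  - by rewrite !linear0l !linear0.
  by rewrite assoclE tmapE J3E !J2E LE -J2E gE.
by rewrite !linear0.
Qed.

Lemma binop_nat (X Y : lmodType K) (u : lin X Y) t :
  g Y (L (L u) t) = L u (g X t).
Proof.
rewrite -!lcompE; move: t; apply: lin_ext2 => x h k.
by rewrite !lcompE L2_J2 !gE LE.
Qed.
End BinaryOperator.

(** * Braiding, coproduct, antipode and counit as operators *)

Section Operators.
Variables (Delta : {linear H -> H ⊗ H}) (eps : {linear H -> K^o}).
Variables (S : {linear H -> H}) (Psi : {linear H ⊗ H -> H ⊗ H}).

Fact P_spec (X : lmodType K) :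
  {p : lin (F (F X)) (F (F X)) | forall x y, p (J2 x y) = J2 x (Psi y)}.
Proof.
exists (lcomp (to_lin assocl) (lcomp (to_lin (Psi ⊠ idfun)) (to_lin assocr))).
by move=> x y; rewrite !lcompE assocr_J2 !to_linE tmapE J2_assocl.
Qed.
Definition P X := sval (P_spec X).
Lemma P_J2 (X : lmodType K) (x : X) y : P X (J2 x y) = J2 x (Psi y).
Proof. exact: svalP (P_spec X) x y. Qed.

Fact D_spec (X : lmodType K) :
  {d : lin (F X) (F (F X)) | forall h x, d (h ⊗ₜ x) = J2 x (Delta h)}.
Proof.
exists (lcomp (to_lin assocl) (to_lin (Delta ⊠ idfun))) => h x.
by rewrite lcompE !to_linE tmapE J2_assocl.
Qed.
Definition D X := sval (D_spec X).
Lemma DE (X : lmodType K) h (x : X) : D X (h ⊗ₜ x) = J2 x (Delta h).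
Proof. exact: svalP (D_spec X) h x. Qed.

Fact A_spec (X : lmodType K) :
  {a : lin (F X) (F X) | forall h x, a (h ⊗ₜ x) = S h ⊗ₜ x}.
Proof. by exists (to_lin (S ⊠ idfun)) => h x; rewrite to_linE tmapE. Qed.
Definition A X := sval (A_spec X).
Lemma AE (X : lmodType K) h (x : X) : A X (h ⊗ₜ x) = S h ⊗ₜ x.
Proof. exact: svalP (A_spec X) h x. Qed.

Fact E_spec (X : lmodType K) :
  {e : lin (F X) X | forall h x, e (h ⊗ₜ x) = (eps h : K) *: x}.
Proof.
exists (lcomp (to_lin lunit) (to_lin (eps ⊠ idfun))) => h x.
by rewrite lcompE !to_linE tmapE lunitE.
Qed.
Definition E X := sval (E_spec X).
Lemma EE (X : lmodType K) h (x : X) : E X (h ⊗ₜ x) = (eps h : K) *: x.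
Proof. exact: svalP (E_spec X) h x. Qed.

Arguments M {X}.
Arguments U {X}.
Arguments P {X}.
Arguments D {X}.
Arguments A {X}.
Arguments E {X}.

Section Transfer.
Variable X : lmodType K.
Implicit Types (x : X) (y : H ⊗ H) (z : H ⊗ H ⊗ H).

Lemma P_J3 x z : P (J3 x z) = J3 x ((Psi ⊠ idfun) z).
Proof.
elim/tensor_ind: z => [y k||s t es et]; last by rewrite !linearD /= es et.
  by rewrite J3E P_J2 tmapE J3E.
by rewrite !linear0.
Qed.

Lemma LP_J3 x z : L P (J3 x z) = J3 x (idr Psi z).
Proof.
elim/tensor_ind: z => [y k||s t es et]; last by rewrite !linearD /= es et.
  elim/tensor_ind: y => [g l||s t es et]; last first.
  - by rewrite !linearDl !linearD /= es et.
  - by rewrite !linear0l !linear0.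
  by rewrite /= assoclE tmapE J3_assocr J3E J2E LE -J2E P_J2.
by rewrite !linear0.
Qed.

Lemma D_J2 x y : D (J2 x y) = J3 x ((Delta ⊠ idfun) y).
Proof.
elim/tensor_ind: y => [h k||s t es et]; last by rewrite !linearD /= es et.
  by rewrite J2E DE tmapE J3E.
by rewrite !linear0.
Qed.

Lemma LD_J2 x y : L D (J2 x y) = J3 x (assocr ((idfun ⊠ Delta) y)).
Proof.
elim/tensor_ind: y => [h k||s t es et]; last by rewrite !linearD /= es et.
  by rewrite J2E LE DE tmapE J3_assocr.
by rewrite !linear0.
Qed.

Lemma A_J2 x y : A (J2 x y) = J2 x ((S ⊠ idfun) y).
Proof.
elim/tensor_ind: y => [h k||s t es et]; last by rewrite !linearD /= es et.
  by rewrite J2E AE tmapE J2E.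
by rewrite !linear0.
Qed.

Lemma LA_J2 x y : L A (J2 x y) = J2 x ((idfun ⊠ S) y).
Proof.
elim/tensor_ind: y => [h k||s t es et]; last by rewrite !linearD /= es et.
  by rewrite J2E LE AE tmapE J2E.
by rewrite !linear0.
Qed.

Lemma E_J2 x y : E (J2 x y) = lunit ((eps ⊠ idfun) y) ⊗ₜ x.
Proof.
elim/tensor_ind: y => [h k||s t es et].
- by rewrite J2E EE tmapE lunitE tensZl.
- by rewrite !linear0 linear0l.
- by rewrite !linearD /= es et linearDl.
Qed.

Lemma LE_J2 x y : L E (J2 x y) = runit ((idfun ⊠ eps) y) ⊗ₜ x.
Proof.
elim/tensor_ind: y => [h k||s t es et].
- by rewrite J2E LE EE tmapE runitE tensZr tensZl.
- by rewrite !linear0 linear0l.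
- by rewrite !linearD /= es et linearDl.
Qed.
End Transfer.

(** For the product this turns [comulM] into the rule [D_M]; for the adjoint action it turns
    [act_mulA] into [B_LM]. *)
Lemma binop_tensor_square (f : {linear H ⊗ H -> H})
    (g : forall X : lmodType K, lin (F (F X)) (F X)) :
    (forall (X : lmodType K) (x : X) y, g X (J2 x y) = f y ⊗ₜ x) ->
  forall (X : lmodType K) (x : X) a b,
  L (g X) (g _ (L P (J2 (J2 x b) a))) = J2 x ((f ⊠ f) (idmid Psi (a ⊗ₜ b))).
Proof.
move=> gE X x a b; rewrite /idmid /=.
elim/tensor_ind: a => [a1 a2||s t es et]; last first.
- by rewrite !linearDl !linearD /= es et.
- by rewrite !linear0l !linear0.
rewrite J2E; elim/tensor_ind: b => [b1 b2||s t es et]; last first.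
- by rewrite !(tensDr, linearD) /= es et.
- by rewrite !(linear0r, linear0).
rewrite J2E LE -J2E P_J2 assoclE tmapE /= assocrE tmapE J2_assocl.
(* The braided middle pair is no longer a pure tensor, so it needs its own induction before the two
   copies of [g] can be evaluated. *)
elim/tensor_ind: (Psi _) => [y1 y2||s t es et]; last first.
- by rewrite !(tensDr, linearD) /= es et.
- by rewrite !(linear0r, linear0).
by rewrite !J2E -J2E gE LE -J2E gE assocrE tmapE J2E.
Qed.

(** * Naturality in the last factor *)

Section Naturality.
Variables (X Y : lmodType K) (f : lin X Y).

Lemma M_nat t : M (L (L f) t) = L f (M t).
Proof. exact: binop_nat M_J2 _ _ f t. Qed.

Lemma P_nat t : P (L (L f) t) = L (L f) (P t).
Proof.
rewrite -!lcompE; move: t; apply: lin_ext2 => x h k.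
by rewrite !lcompE L2_J2 !P_J2 L2_J2.
Qed.

Lemma D_nat t : D (L f t) = L (L f) (D t).
Proof.
rewrite -!lcompE; move: t; apply: lin_ext => h x.
by rewrite !lcompE LE !DE L2_J2.
Qed.

Lemma A_nat t : A (L f t) = L f (A t).
Proof.
by rewrite -!lcompE; move: t; apply: lin_ext => h x; rewrite !lcompE LE !AE LE.
Qed.

Lemma E_nat t : E (L f t) = f (E t).
Proof.
rewrite -!lcompE; move: t; apply: lin_ext => h x.
by rewrite !lcompE LE !EE linearZ.
Qed.

Lemma U_nat t : U (f t) = L f (U t).
Proof. by rewrite !UE LE. Qed.
End Naturality.

(** * The braided Hopf algebra axioms as rewriting rules for operators *)

Section HopfRules.
Hypothesis HH : braided_Hopf_algebra Delta eps S Psi.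

Section Rules.
Variable X : lmodType K.

Lemma M_M (t : F (F (F X))) : M (M t) = M (L M t).
Proof.
rewrite -!lcompE; move: t; apply: lin_ext3 => x h k l.
rewrite !lcompE (binop_J3 M_J2) (L_binop_J3 M_J2) !M_J2.
by rewrite assoclE !tmapE !tmulE mulrA.
Qed.

Lemma M_U (t : F X) : M (U t) = t.
Proof.
rewrite -[RHS](to_linE idfun) -!lcompE; move: t; apply: lin_ext => h x.
by rewrite lcompE to_linE UE -J2E M_J2 tmulE mul1r.
Qed.

Lemma M_LU (t : F X) : M (L U t) = t.
Proof.
rewrite -[RHS](to_linE idfun) -!lcompE; move: t; apply: lin_ext => h x.
by rewrite lcompE to_linE LE UE -J2E M_J2 tmulE mulr1.
Qed.

Lemma D_D (t : F X) : D (D t) = L D (D t).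
Proof.
rewrite -!lcompE; move: t; apply: lin_ext => h x.
rewrite !lcompE DE D_J2 LD_J2; apply: (congr1 (J3 x)).
by move: (coassociative HH h) => /(congr1 assocr) <-; apply/esym/assoclK.
Qed.

Lemma E_D (t : F X) : E (D t) = t.
Proof.
rewrite -[RHS](to_linE idfun) -!lcompE; move: t; apply: lin_ext => h x.
by rewrite lcompE to_linE DE E_J2; apply: tens_congl; exact: counitl HH h.
Qed.

Lemma LE_D (t : F X) : L E (D t) = t.
Proof.
rewrite -[RHS](to_linE idfun) -!lcompE; move: t; apply: lin_ext => h x.
by rewrite lcompE to_linE DE LE_J2; apply: tens_congl; exact: counitr HH h.
Qed.

Lemma braid (t : F (F (F X))) : P (L P (P t)) = L P (P (L P t)).
Proof.
rewrite -!lcompE; move: t; apply: lin_ext3 => x h k l.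
rewrite !lcompE !(P_J3, LP_J3).
by apply: (congr1 (J3 x)); exact: braid_eq HH _.
Qed.

Lemma P_M (t : F (F (F X))) : P (M t) = L M (P (L P t)).
Proof.
rewrite -!lcompE; move: t; apply: lin_ext3 => x h k l.
rewrite !lcompE (binop_J3 M_J2) LP_J3 P_J3 (L_binop_J3 M_J2) P_J2.
by apply: (congr1 (J2 x)); exact: braiding_mull HH _.
Qed.

Lemma P_LM (t : F (F (F X))) : P (L M t) = M (L P (P t)).
Proof.
rewrite -!lcompE; move: t; apply: lin_ext3 => x h k l.
rewrite !lcompE P_J3 LP_J3 (binop_J3 M_J2) (L_binop_J3 M_J2) P_J2.
by apply: (congr1 (J2 x)); exact: braiding_mulr HH _.
Qed.

Lemma P_U (t : F X) : P (U t) = L U t.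
Proof.
rewrite -!lcompE; move: t; apply: lin_ext => h x.
by rewrite !lcompE LE !UE -J2E P_J2 (braiding_1l HH) J2E.
Qed.

Lemma P_LU (t : F X) : P (L U t) = U t.
Proof.
rewrite -!lcompE; move: t; apply: lin_ext => h x.
by rewrite !lcompE LE !UE -J2E P_J2 (braiding_1r HH) J2E.
Qed.

Lemma LD_P (t : F (F X)) : L D (P t) = P (L P (D t)).
Proof.
rewrite -!lcompE; move: t; apply: lin_ext2 => x h k.
rewrite !lcompE D_J2 LP_J3 P_J3 P_J2 LD_J2.
by apply: (congr1 (J3 x)); exact: braiding_Deltar HH _.
Qed.

Lemma D_P (t : F (F X)) : D (P t) = L P (P (L D t)).
Proof.
rewrite -!lcompE; move: t; apply: lin_ext2 => x h k.
rewrite !lcompE P_J2 D_J2 LD_J2 P_J3 LP_J3.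
by apply: (congr1 (J3 x)); exact: braiding_Deltal HH _.
Qed.

Lemma LE_P (t : F (F X)) : L E (P t) = E t.
Proof.
rewrite -!lcompE; move: t; apply: lin_ext2 => x h k.
rewrite !lcompE P_J2 LE_J2 E_J2.
by apply: tens_congl; exact: braiding_epsr HH _.
Qed.

Lemma E_P (t : F (F X)) : E (P t) = L E t.
Proof.
rewrite -!lcompE; move: t; apply: lin_ext2 => x h k.
rewrite !lcompE P_J2 LE_J2 E_J2.
by apply: tens_congl; exact: braiding_epsl HH _.
Qed.

Lemma P_A (t : F (F X)) : P (A t) = L A (P t).
Proof.
rewrite -!lcompE; move: t; apply: lin_ext2 => x h k.
rewrite !lcompE A_J2 !P_J2 LA_J2.
by apply: (congr1 (J2 x)); exact: braiding_Sl HH _.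
Qed.

Lemma P_LA (t : F (F X)) : P (L A t) = A (P t).
Proof.
rewrite -!lcompE; move: t; apply: lin_ext2 => x h k.
rewrite !lcompE LA_J2 !P_J2 A_J2.
by apply: (congr1 (J2 x)); exact: braiding_Sr HH _.
Qed.

Lemma E_U (t : X) : E (U t) = t.
Proof. by rewrite UE EE (counit1 HH) scale1r. Qed.

Lemma D_U (t : X) : D (U t) = U (U t).
Proof. by rewrite !UE DE (comul1 HH) J2E. Qed.

Lemma E_M (t : F (F X)) : E (M t) = E (E t).
Proof.
rewrite -!lcompE; move: t; apply: lin_ext2 => x h k.
rewrite !lcompE M_J2 J2E tmulE !EE (counitM HH) linearZ /= EE.
by rewrite scalerA.
Qed.

Lemma M_A_D (t : F X) : M (A (D t)) = U (E t).
Proof.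
rewrite -!lcompE; move: t; apply: lin_ext => h x.
by rewrite !lcompE DE A_J2 M_J2 (antipodel HH) EE UE tensZl tensZr.
Qed.

Lemma M_LA_D (t : F X) : M (L A (D t)) = U (E t).
Proof.
rewrite -!lcompE; move: t; apply: lin_ext => h x.
by rewrite !lcompE DE LA_J2 M_J2 (antipoder HH) EE UE tensZl tensZr.
Qed.
End Rules.

(** The grouping [(a b)(c d)] exposes the product of the last two factors, where an antipode can
    cancel; read backwards, it restores the left-nested product. *)
Lemma M_M_M (X : lmodType K) (t : F (F (F (F X)))) :
  M (M (M t)) = M (M (L (L M) t)).
Proof. by rewrite [M (M t)]M_M M_M (L22 (@M_M _)) -M_M. Qed.

(** * Convolution on the braided tensor square and antimultiplicativity of the antipode *)

Section TensorSquare.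

(* The coproduct of the braided tensor product coalgebra [H ⊗ H]. *)
Definition C (X : lmodType K) : lin (F (F X)) (F (F (F (F X)))) :=
  lcomp (L P) (lcomp D (L D)).
Arguments C {X}.

Lemma C_def (X : lmodType K) (t : F (F X)) : C t = L P (D (L D t)).
Proof. by rewrite !lcompE. Qed.

Lemma LC_def (X : lmodType K) (t : F (F (F X))) :
  L C t = L (L P) (L D (L (L D) t)).
Proof. by rewrite !Lcomp. Qed.

Lemma LLC_def (X : lmodType K) (t : F (F (F (F X)))) :
  L (L C) t = L (L (L P)) (L (L D) (L (L (L D)) t)).
Proof. by rewrite -!Lcomp; apply: L_ext => u; rewrite !lcompE LC_def. Qed.

Lemma C_nat (X Y : lmodType K) (f : lin X Y) t :
  C (L (L f) t) = L (L (L (L f))) (C t).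
Proof. by rewrite !C_def (L22 (@D_nat _ _ _)) !D_nat (L22 (@P_nat _ _ _)). Qed.

Lemma D_M (X : lmodType K) (t : F (F X)) : D (M t) = L M (M (C t)).
Proof.
rewrite C_def -!lcompE; move: t; apply: lin_ext2 => x h k.
rewrite !lcompE M_J2 DE J2E LE !DE (binop_tensor_square M_J2).
apply: (congr1 (J2 x)); rewrite -(tmapE Delta Delta).
exact: (comulM HH).
Qed.

(** This and [LLE_LLE_C] are the counit laws of [C]; they remove a trivial factor from a convolution
    product. *)
Lemma E_E_C (X : lmodType K) (t : F (F X)) : E (E (C t)) = t.
Proof. by rewrite C_def E_nat E_D E_P (L20 (@E_D _)). Qed.

Lemma LLE_LLE_C (X : lmodType K) (t : F (F X)) :
  L (L E) (L (L E) (C t)) = t.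
Proof. by rewrite C_def (L21 (@LE_P _)) LE_D (L20 (@LE_D _)). Qed.

(** Once [D_P] and [LD_P] carry the coproducts through the braiding, coassociativity of [D] applies
    in each factor separately. *)
Lemma C_C (X : lmodType K) (t : F (F X)) : C (C t) = L (L C) (C t).
Proof.
rewrite LLC_def !C_def (L23 (@D_P _)) !D_nat D_D.
rewrite (L22 (L22 (L22 (@D_D _)))).
by rewrite -(L22 (@P_nat _ _ _)) (L23 (@LD_P _)) -(L22 (@P_nat _ _ _))
  !(L22 (@D_nat _ _ _)).
Qed.

(* Candidate right convolution inverse of the product. *)
Definition N (X : lmodType K) : lin (F (F X)) (F X) :=
  lcomp M (lcomp P (lcomp A (L A))).
Arguments N {X}.

Lemma N_def (X : lmodType K) (t : F (F X)) : N t = M (P (A (L A t))).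
Proof. by rewrite !lcompE. Qed.

Lemma LN_def (X : lmodType K) (t : F (F (F X))) :
  L N t = L M (L P (L A (L (L A) t))).
Proof. by rewrite !Lcomp. Qed.

(** Up to braiding the left side is [h_(1) g_(1) S(g_(2)) S(h_(2))]. The inner pair collapses first,
    its counit passes through the braiding by [E_P], and then the outer pair collapses. *)
Lemma M_LN_M_C (X : lmodType K) (t : F (F X)) :
  M (L N (M (C t))) = U (E (E t)).
Proof.
rewrite LN_def -!M_nat C_def D_nat.
rewrite (L22 (L22 (@P_A _))) (L22 (L22 (@P_LA _))) -(L23 (@D_P _)).
rewrite -M_M_M [M (M (L (L (L A)) _))]M_M !(L22 (@M_nat _ _ _)).
rewrite (L32 (@M_LA_D _)) -(L22 (@U_nat _ _ _)) M_LU.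
by rewrite (L21 (@E_P _)) -D_nat M_LA_D E_nat.
Qed.

Lemma A_M (X : lmodType K) (t : F (F X)) : A (M t) = M (P (A (L A t))).
Proof.
(* The two bracketings of the convolution product (S ∘ μ) * μ * N. *)
rewrite -N_def.
have <-: M (M (L M (A (M (C (L (L N) (C t))))))) = A (M t).
  rewrite C_nat C_C M_nat A_nat (L22 (@M_nat _ _ _)) M_M M_nat A_nat.
  by rewrite (L43 (@M_LN_M_C _)) M_LU -!A_nat -!M_nat LLE_LLE_C.
(* By [D_M], the factor [(S ∘ μ) * μ] is the antipode axiom evaluated at a product, so only [N]
   survives. *)
by rewrite -A_nat -D_M M_A_D M_U E_M !E_nat E_E_C.
Qed.
End TensorSquare.

(** * The adjoint action as an operator and its identities *)

Section AdjointAction.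

Fact B_spec (X : lmodType K) : {b : lin (F (F X)) (F X) |
  forall t, b t = M (M (L (L A) (L P (D t))))}.
Proof.
exists (lcomp M (lcomp M (lcomp (L (L A)) (lcomp (L P) D)))) => t.
by rewrite !lcompE.
Qed.
Definition B X := sval (B_spec X).
Arguments B {X}.
Lemma B_def (X : lmodType K) (t : F (F X)) :
  B t = M (M (L (L A) (L P (D t)))).
Proof. exact: svalP (B_spec X) t. Qed.

Lemma B_J2 (X : lmodType K) (x : X) y :
  B (J2 x y) = braided_adjoint Delta S Psi y ⊗ₜ x.
Proof.
have MMLLA z : M (M (L (L A) (J3 x z))) = tmul ((tmul ⊠ S) z) ⊗ₜ x.
  elim/tensor_ind: z => [y' k||s t es et].
  - by rewrite J3E L2_J2 AE M_J2 tmapE -(M_J2 x) J2E.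
  - by rewrite !linear0 linear0l.
  - by rewrite !linearD /= es et linearDl.
by rewrite B_def D_J2 LP_J3 MMLLA.
Qed.

Lemma LB_def (X : lmodType K) (t : F (F (F X))) :
  L B t = L M (L M (L (L (L A)) (L (L P) (L D t)))).
Proof.
by rewrite -!Lcomp; apply: L_ext => u; rewrite B_def !lcompE.
Qed.

Lemma LLB_def (X : lmodType K) (t : F (F (F (F X)))) :
  L (L B) t =
  L (L M) (L (L M) (L (L (L (L A))) (L (L (L P)) (L (L D) t)))).
Proof.
by rewrite -!Lcomp; apply: L_ext => u; rewrite LB_def !lcompE.
Qed.

Lemma B_nat (X Y : lmodType K) (f : lin X Y) t : B (L (L f) t) = L f (B t).
Proof. exact: binop_nat B_J2 _ _ f t. Qed.

(** Up to braiding the left side is [h_(1) a S(h_(2)) h_(3)]; the antipode axiom cancels the last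
    two factors and the counit law restores [h a]. *)
Lemma M_B_D (X : lmodType K) (t : F (F X)) : M (B (L P (D t))) = M t.
Proof.
rewrite B_def D_nat D_D -(L23 (@LD_P _)) M_M_M.
by rewrite (L32 (L32 (@M_A_D _))) (L21 (@LE_P _)) M_nat M_LU LE_D.
Qed.

Lemma B_LM (X : lmodType K) (t : F (F (F X))) :
  B (L M t) = M (L B (B (L P (D t)))).
Proof.
rewrite B_def D_nat (L23 (@P_LM _)) -(L22 (@M_nat _ _ _)) -M_M.
(* After [h_(1) a] is expanded, coassociativity makes its new leg [h_(12)] and the [h_(2)] under the
   antipode the two legs of one coproduct: those of the action on [b]. *)
rewrite -[M (L _ _)]M_B_D !D_nat D_D !(L22 (@P_nat _ _ _)) -(L23 (@LD_P _)).
by rewrite !B_nat LB_def -!M_M.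
Qed.

(** [P] slides through each constituent of [B]: the products by [P_LM], the antipode by [P_LA], the
    inner braiding by [braid], the coproduct by [D_P]. *)
Lemma P_LB (X : lmodType K) (t : F (F (F X))) : P (L B t) = B (L P (P t)).
Proof.
rewrite LB_def P_LM P_LM -M_nat !P_nat !(L22 (@P_nat _ _ _)).
rewrite (L22 (L22 (@P_LA _))) -(L33 (@braid _)) -D_P -D_nat.
by rewrite B_def.
Qed.

(** Both sides are [h_(1) k_(1) a S(k_(2)) S(h_(2))] up to braiding; on the left this needs [D_M]
    for the coproduct and [A_M] for the antipode of a product. *)
Lemma B_M (X : lmodType K) (t : F (F (F X))) : B (M t) = B (L B t).
Proof.
rewrite B_def D_M (L23 (@P_M _)) (L24 (L24 (@A_M _))) -!M_nat C_def D_nat.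
rewrite (L22 (L22 (L22 (@P_A _)))) (L22 (L22 (L22 (@P_LA _)))).
rewrite M_nat -M_M_M.
(* The right side is now unfolded: the outer braiding moves through the two products of the inner
   action, and later through its antipode. *)
rewrite B_def D_nat LLB_def (L23 (@P_LM _)) (L23 (@P_LM _)).
rewrite -!(L22 (@M_nat _ _ _)) !(L22 (@P_nat _ _ _)).
rewrite (L22 (L22 (@P_nat _ _ _))) (L22 (L22 (L22 (@P_LA _)))).
by rewrite -!M_M.
Qed.

(** This is the antipode axiom at [1], whose coproduct is [1 ⊗ 1]. *)
Lemma A_U (X : lmodType K) (t : X) : A (U t) = U t.
Proof. by rewrite -[LHS]M_LU -A_nat -U_nat -D_U M_A_D E_U. Qed.

Lemma B_U (X : lmodType K) (t : F X) : B (U t) = t.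
Proof.
rewrite B_def D_U -U_nat P_U -U_nat (L21 (@A_U _)).
by rewrite M_U M_LU.
Qed.

Lemma B_LU (X : lmodType K) (t : F X) : B (L U t) = U (E t).
Proof.
rewrite B_def D_nat (L21 (@P_LU _)) -(L22 (@U_nat _ _ _)) M_LU.
exact: M_LA_D.
Qed.
End AdjointAction.

(** Axioms in which the action is absent are axioms of [H]; each other one is an identity for [B]
    read at the last factor [1 : K^o]. *)
Lemma braided_adjoint_module_algebra :
  left_braided_module_algebra Delta eps Psi (braided_adjoint Delta S Psi) Psi.
Proof.
(* From here the action is tied to [B] only through [B_J2]; as a variable it stays folded under
   simplification. *)
move: B_J2; generalize (braided_adjoint Delta S Psi) => ad B_J2; split.
- exact: braiding_bij HH.
- exact: braiding_mull HH.
- exact: braiding_mulr HH.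
- exact: braiding_Deltar HH.
- apply: tensor_linear_ext => h y; apply: tens1_inj.
  rewrite [LHS]/= [RHS]/= !tmapE -[RHS]M_J2 -(binop_tensor_square B_J2).
  by rewrite -DE -B_LM LE M_J2 -J2E B_J2.
- move=> z; apply: tens1_inj; rewrite [LHS]/= [RHS]/= -!B_J2.
  by rewrite -(binop_J3 M_J2) -(L_binop_J3 B_J2) B_M.
- move=> z; apply: J2_inj; rewrite [LHS]/= [RHS]/=.
  rewrite -P_J2 -(L_binop_J3 B_J2) P_LB -(binop_J3 B_J2).
  by rewrite -[assocr _]/(idr Psi _) -LP_J3 -P_J3.
- by move=> a; apply: tens1_inj; rewrite -B_J2 J2E -UE B_U.
- move=> h; apply: tens1_inj; rewrite -B_J2 J2E -UE -LE B_LU EE UE.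
  by rewrite tensZl tensZr.
Qed.
End HopfRules.
End Operators.

End LeftTensor.

Theorem proposition2p3 (K : fieldType) (H : algType K)
    (Delta : {linear H -> H ⊗ H}) (eps : {linear H -> K^o})
    (S : {linear H -> H}) (Psi : {linear H ⊗ H -> H ⊗ H}) :
  braided_Hopf_algebra Delta eps S Psi ->
  left_braided_module_algebra Delta eps Psi (braided_adjoint Delta S Psi) Psi.
Proof. exact: braided_adjoint_module_algebra. Qed.
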